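(* Let $\alpha>0$ and $\xi<0$. Let $\mu_{1,n}$ be the smallest zero of the polynomial $A_n(\lambda)$ defined by $$A_n(\lambda)=\Big(\lambda-2+\frac{\xi-\alpha}{n}\Big)A_{n-1}(\lambda)-\Big(1+\frac{\alpha}{n-1}\Big)A_{n-2}(\lambda),\quad n\ge2,$$ with $A_0(\lambda)=1$ and $A_1(\lambda)=\lambda-\alpha-1+\xi-\frac{\xi}{\xi-\alpha}$. Then $$\lim_{n\to\infty}\mu_{1,n}=0.$$
   Context: The number $\mu_{1,n}$ arises from the Markov-Bernstein inequality $c_1((p')^2)\le\frac1{\mu_{1,n}}c_0(p^2)$ for real polynomials $p$ of degree at most $n$, where $c_0$ is integration against $(x-\xi)x^{\alpha-1}e^{-x}dx$ on $]0,+\infty[$ and $c_1$ is integration against $x^{\alpha}e^{-x}dx$ on $]0,+\infty[$. The zeros of $A_n$ are real and positive. *)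

(* Defs.v *)
From HB Require Import structures.
From mathcomp Require Import all_boot all_order all_algebra.
From mathcomp Require Import all_classical all_reals all_analysis.

Set Implicit Arguments.
Unset Strict Implicit.
Unset Printing Implicit Defensive.

Import Order.TTheory GRing.Theory Num.Theory.
Import numFieldNormedType.Exports.

Local Open Scope ring_scope.

(* A_n(lambda), with 'X in the role of lambda. In the recursive branch the
   index is n = k + 2, so that k.+1%:R is n - 1. *)
Fixpoint MBpoly (R : realType) (alpha xi : R) (n : nat) : {poly R} :=
  match n with
  | 0 => 1
  | 1 => 'X + (- alpha - 1 + xi - xi / (xi - alpha))%:P
  | (k.+1 as m).+1 =>
      ('X + (- 2 + (xi - alpha) / k.+2%:R)%:P) * MBpoly alpha xi m
      - (1 + alpha / k.+1%:R)%:P * MBpoly alpha xi k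
  end.

Definition smallest_zero (R : realType) (p : {poly R}) (x : R) : Prop :=
  root p x /\ forall y : R, root p y -> x <= y.

(* Main.v *)
Require Import Defs.
From HB Require Import structures.
From mathcomp Require Import all_boot all_order all_algebra.
From mathcomp Require Import all_classical all_reals all_analysis.
From mathcomp Require Import ring lra.

Set Implicit Arguments.
Unset Strict Implicit.
Unset Printing Implicit Defensive.

Import Order.TTheory GRing.Theory Num.Theory.
Import numFieldNormedType.Exports.

Local Open Scope classical_set_scope.
Local Open Scope ring_scope.

(** Put [B_n = (-1)^n A_n].  For [x <= 0] the recurrence propagates
    [B_(n+1) >= (1 + alpha / (n+1)) B_n > 0], so all zeros are positive.
    At the smallest zero of [A_(n+1)] the recurrence gives [B_(n+2)] the sign
    opposite to [B_n], whence by the intermediate value theorem the smallest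
    zeros decrease.  Finally, if [B_n(x) > 0] for all [n] and some [x > 0], the
    ratios [r_n = B_(n+1)(x) / B_n(x)] satisfy eventually
    [r_(n+1) <= 2 - x/2 - 1/r_n <= r_n - x/2], as [r + 1/r >= 2]; they cannot
    stay positive.  So some, hence every later, smallest zero is at most [x]. *)

Section SignedMBpoly.
Variables (R : realType) (alpha xi : R).
Hypotheses (halpha : 0 < alpha) (hxi : xi < 0).

Definition signedMB (n : nat) (x : R) : R :=
  (-1) ^+ n * (MBpoly alpha xi n).[x].

Lemma signedMB0 x : signedMB 0 x = 1.
Proof. by rewrite /signedMB expr0 mul1r hornerC. Qed.

Lemma signedMB1 x :
  signedMB 1 x = alpha + 1 - xi + xi / (xi - alpha) - x.
Proof. by rewrite /signedMB expr1 /= hornerD hornerX hornerC; ring. Qed.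

Lemma signedMBSS n x : signedMB n.+2 x =
  (2 - x + (alpha - xi) / n.+2%:R) * signedMB n.+1 x
  - (1 + alpha / n.+1%:R) * signedMB n x.
Proof.
rewrite /signedMB [MBpoly _ _ n.+2]/=.
rewrite -/(MBpoly alpha xi n.+1) hornerD hornerN 2!hornerM hornerD hornerX.
by rewrite 2!hornerC !exprS; ring.
Qed.

(** Both parts go through one induction: the growth bound absorbs the subtracted term of the
    recurrence at the cost of one copy of [signedMB n.+1 x], leaving the factor
    [1 - x + (alpha - xi) / n.+2%:R], which is at least [1 + alpha / n.+2%:R]. *)
Lemma signedMB_growth n (x : R) : x <= 0 ->
  0 < signedMB n x /\ (1 + alpha / n.+1%:R) * signedMB n x <= signedMB n.+1 x.
Proof.
move: (halpha) (hxi) => a0 xi0 x0; elim: n => [|n [B0 B1]].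
  rewrite signedMB0 signedMB1 divr1; split=> //.
  have : 0 <= xi / (xi - alpha) by apply: mulr_le0; rewrite ?invr_le0; lra.
  by set t := xi / _; lra.
have a_gt0 : 0 < alpha / n.+1%:R :> R by rewrite divr_gt0.
have Bn1 : 0 < signedMB n.+1 x.
  by apply: lt_le_trans B1; rewrite mulr_gt0 ?addr_gt0.
split=> //; rewrite signedMBSS.
have c_ge0 : 0 <= (- xi / n.+2%:R) * signedMB n.+1 x.
  by rewrite mulr_ge0 ?divr_ge0 ?oppr_ge0 // ltW.
have d_ge0 : 0 <= - x * signedMB n.+1 x by rewrite mulr_ge0 ?oppr_ge0 // ltW.
(* The gap in the new bound is exactly the sum of these two terms and the gap in the old bound. *)
move: B1; rewrite -subr_ge0 => /(addr_ge0 (addr_ge0 c_ge0 d_ge0)) B1.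
rewrite -subr_ge0; apply: (le_trans B1).
by rewrite le_eqVlt; apply/predU1P; left; ring.
Qed.

Lemma signedMB_gt0 n (x : R) : x <= 0 -> 0 < signedMB n x.
Proof. by case/(signedMB_growth n). Qed.

Lemma root_signedMB n x : root (MBpoly alpha xi n) x = (signedMB n x == 0).
Proof. by rewrite /signedMB mulf_eq0 signr_eq0. Qed.

Lemma signedMB_ivt n x : signedMB n x <= 0 ->
  exists2 y, 0 <= y <= x & root (MBpoly alpha xi n) y.
Proof.
move=> Bx; have x0 : 0 <= x.
  by rewrite leNgt; apply/negP => /ltW/(signedMB_gt0 n); rewrite ltNge Bx.
(* The extra minus sign turns the fall from a positive value at 0 into the rise that [poly_ivt]
   expects. *)
have [|y yx] := @poly_ivt R (- (-1) ^+ n *: MBpoly alpha xi n) 0 x x0.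
  rewrite !hornerZ !mulNr -!/(signedMB _ _) oppr_le0 oppr_ge0 Bx andbT.
  exact/ltW/signedMB_gt0.
by rewrite rootZ ?oppr_eq0 ?signr_eq0//; exists y.
Qed.

Lemma smallest_zero_le n m x : smallest_zero (MBpoly alpha xi n) m ->
  signedMB n x <= 0 -> m <= x.
Proof.
by move=> [_ m_min] /signedMB_ivt[y /andP[_ yx] /m_min my]; apply: le_trans yx.
Qed.

Lemma smallest_zero_gt0 n m : smallest_zero (MBpoly alpha xi n) m -> 0 < m.
Proof.
move=> [m_root _]; rewrite ltNge; apply/negP => /(signedMB_gt0 n).
by rewrite root_signedMB in m_root; rewrite (eqP m_root) ltxx.
Qed.

Lemma signedMB_nonpos_ex (x : R) : 0 < x -> exists n, signedMB n x <= 0.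
Proof.
move: (halpha) (hxi) => a0 xi0 x0; apply: contrapT => noex.
have Bgt0 n : 0 < signedMB n x.
  by rewrite ltNge; apply/negP => Bn; apply: noex; exists n.
pose r n := signedMB n.+1 x / signedMB n x.
have r_gt0 n : 0 < r n by rewrite divr_gt0.
have r_rec n : r n.+1 = 2 - x + (alpha - xi) / n.+2%:R
    - (1 + alpha / n.+1%:R) / r n.
  have := Bgt0 n; have := Bgt0 n.+1 => /lt0r_neq0 B1 /lt0r_neq0 B0.
  rewrite /r signedMBSS; set u := _^-1; set v := _ / n.+1%:R.
  by field; rewrite B0 B1.
(* From this index on, the term [(alpha - xi) / n.+2%:R] uses up at most half of [x]. *)
pose N := Num.bound ((alpha - xi) / (x / 2)).
have r_step n : (N <= n)%N -> r n.+1 <= r n - x / 2.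
  move=> Nn; rewrite r_rec.
  have small : (alpha - xi) / n.+2%:R <= x / 2.
    rewrite ler_pdivrMr// mulrC -ler_pdivrMr ?divr_gt0//.
    apply: (@le_trans _ _ N%:R); last by rewrite ler_nat 2?leqW.
    by apply/ltW/archi_boundP; rewrite !divr_ge0//; lra.
  have rV_gt0 : 0 < (r n)^-1 by rewrite invr_gt0.
  have rrV : r n * (r n)^-1 = 1 by rewrite divff// gt_eqF.
  have aM_ge0 : 0 <= alpha / n.+1%:R / r n by rewrite !divr_ge0// ltW.
  have amgm : 2 <= r n + (r n)^-1.
    have := mulr_ge0 (sqr_ge0 (r n - 1)) (ltW rV_gt0).
    have -> : (r n - 1) ^+ 2 * (r n)^-1
      = r n * (r n * (r n)^-1) - 2 * (r n * (r n)^-1) + (r n)^-1 by ring.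
    by rewrite rrV; lra.
  rewrite [(1 + _) / _]mulrDl mul1r.
  move: small aM_ge0 amgm.
  by move: ((r n)^-1) (_ / n.+2%:R) (alpha / _ / _) => u v w; lra.
have r_lin k : r (N + k)%N <= r N - x / 2 * k%:R.
  elim: k => [|k IH]; first by rewrite addn0 mulr0 subr0.
  have := r_step _ (leq_addr k N); rewrite addnS -(natr1 k); lra.
have x2 : 0 < x / 2 by rewrite divr_gt0.
(* After this many steps the linear bound is negative, although every ratio is positive. *)
have := r_lin (Num.bound (r N / (x / 2))).
have := archi_boundP (divr_ge0 (ltW (r_gt0 N)) (ltW x2)).
rewrite ltr_pdivrMr// mulrC => Nlt /(lt_le_trans (r_gt0 _)).
by rewrite subr_gt0 ltNge (ltW Nlt).
Qed.

Section SmallestZeros.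
Variable mu : nat -> R.
Hypothesis hmu : forall n : nat, (1 <= n)%N ->
  smallest_zero (MBpoly alpha xi n) (mu n).

Lemma signedMB_mu n : signedMB n.+1 (mu n.+1) = 0.
Proof. by apply/eqP; rewrite -root_signedMB; case: (hmu (ltn0Sn n)). Qed.

Lemma mu_decr_of_gt0 n : 0 < signedMB n (mu n.+1) -> mu n.+2 < mu n.+1.
Proof.
move=> Bn.
have BSS : signedMB n.+2 (mu n.+1) < 0.
  rewrite signedMBSS signedMB_mu mulr0 sub0r oppr_lt0 mulr_gt0//.
  by rewrite ltr_wpDr ?divr_ge0// ltW.
rewrite lt_neqAle (smallest_zero_le (hmu _) (ltW BSS)) // andbT.
by apply: contra_ltN BSS => /eqP <-; rewrite signedMB_mu.
Qed.

(** A nonpositive value at [mu n.+2] would give [mu n.+1 <= mu n.+2], against the strict decrease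
    that the induction hypothesis provides. *)
Lemma signedMB_mu_gt0 n : 0 < signedMB n (mu n.+1).
Proof.
elim: n => [|n /mu_decr_of_gt0 IH]; first by rewrite signedMB0.
rewrite ltNge; apply/negP => /(smallest_zero_le (hmu _)) => /(_ isT).
by rewrite leNgt IH.
Qed.

Lemma mu_nonincreasing m n : (1 <= m <= n)%N -> mu n <= mu m.
Proof.
case/andP=> m1 /subnKC <-; elim: (n - m)%N => [|k IH]; first by rewrite addn0.
apply: le_trans IH; rewrite addnS; case: m m1 => // m _.
exact/ltW/mu_decr_of_gt0/signedMB_mu_gt0.
Qed.

End SmallestZeros.
End SignedMBpoly.

Theorem mainTheorem4 (R : realType) (alpha xi : R) (mu : nat -> R)
    (halpha : 0 < alpha) (hxi : xi < 0)
    (hmu : forall n : nat, (1 <= n)%N -> smallest_zero (MBpoly alpha xi n) (mu n)) :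
  mu n @[n --> \oo] --> (0 : R).
Proof.
apply/cvgrPdist_le => e e0.
have [N BN] := signedMB_nonpos_ex halpha hxi e0.
(* The sequence [mu] is constrained only from index 1 on; index 0 is excluded because [signedMB 0]
   is the constant 1. *)
have N1 : (1 <= N)%N.
  by case: N BN => //; rewrite signedMB0 ler10.
near=> n.
have Nn : (N <= n)%N by near: n; exact: nbhs_infty_ge.
have n1 := leq_trans N1 Nn.
rewrite sub0r normrN gtr0_norm; last exact: (smallest_zero_gt0 halpha hxi (hmu n n1)).
apply: (le_trans (mu_nonincreasing halpha hxi hmu (m := N) _)).
  by rewrite N1.
exact: (smallest_zero_le halpha hxi (hmu N N1) BN).
Unshelve. all: by end_near.
Qed.
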